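(* Let $B$ be a simple Bratteli diagram of strict rank $d$, let $\mathcal F$ be a skeleton on $B$ with sets $\widetilde V,\overline V$, and let $\sigma:\widetilde V\to\overline V$ be a bijection. Suppose that for all sufficiently large $n$ the graph $\mathcal H_n$ is positively strongly connected and the incidence matrix $F_n$ satisfies the balance relations $$\sum_{w\in W_{\tilde v}}\tilde f^{(n)}_{u,w}=\sum_{w\in W'_{\sigma(\tilde v)}}\bar f^{(n)}_{u,w}\qquad\text{for all }u\in V_{n+1},\ \tilde v\in\widetilde V.$$ Then there is a perfect ordering $\omega$ on $B$ whose maximal paths are exactly the $M_{\tilde v}$ ($\tilde v\in\widetilde V$), whose minimal paths are exactly the $m_{\bar v}$ ($\bar v\in\overline V$), for which $\tilde e_w$ and $\bar e_w$ are the maximal and minimal edges of $r^{-1}(w)$ for every $w\in V_n$, $n\ge2$, and whose Vershik map satisfies $\varphi_\omega(M_{\tilde v})=m_{\sigma(\tilde v)}$ for all $\tilde v\in\widetilde V$.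
   Context: A Bratteli diagram $B$ has levels $V_n$ ($V_0=\{v_0\}$) and edge sets $E_n$ from $V_{n-1}$ to $V_n$ with source/range maps $s,r$; $X_B$ is its Cantor path space; standing assumption: $B$ aperiodic. Incidence matrix $F_n=(f^{(n)}_{u,w})_{u\in V_{n+1},w\in V_n}$: number of edges from $w$ to $u$. $B$ is simple if for every $n$ there is $m>n$ with every vertex of $V_n$ joined to every vertex of $V_m$. Strict rank $d$: $|r^{-1}(v)|\ge2$ for $v\ne v_0$ and $V_n=V$, $|V|=d$, for all $n\ge1$ (levels identified). An ordering is a linear order on each $r^{-1}(v)$; it is perfect if it admits a Vershik map $\varphi_\omega$ (a homeomorphism of $X_B$ sending maximal infinite paths onto minimal ones and sending each non-maximal $x$ to the path obtained by replacing its first non-maximal edge by its successor and the preceding edges by the minimal path to the source of that successor). A path is vertical if it passes through the same vertex at every level $\ge1$. Skeleton: choose $\widetilde V,\overline V\subseteq V$ with $|\widetilde V|=|\overline V|=k\le d$; for each $\tilde v\in\widetilde V$ a vertical path $M_{\tilde v}$ through $\tilde v$ and for each $\bar v\in\overline V$ a vertical path $m_{\bar v}$ through $\bar v$, such that if $v\in\widetilde V\cap\overline V$ then $M_v,m_v$ share no edge; maps $w\mapsto\tilde v(w)\in\widetilde V$, $w\mapsto\bar v(w)\in\overline V$ on $V$; and for each $n\ge2$, $w\in V_n$, two distinct edges $\tilde e_w,\bar e_w\in r^{-1}(w)$ with $s(\tilde e_w)=\tilde v(w)$, $s(\bar e_w)=\bar v(w)$, where $\tilde e_w$ is the level-$n$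 edge of $M_w$ if $w\in\widetilde V$ and $\bar e_w$ is the level-$n$ edge of $m_w$ if $w\in\overline V$. The collection $\mathcal F$ of these paths and edges is a skeleton. $W_{\tilde v}=\{w\in V:\tilde v(w)=\tilde v\}$, $W'_{\bar v}=\{w\in V:\bar v(w)=\bar v\}$, $[\bar v,\tilde v]=W'_{\bar v}\cap W_{\tilde v}$. The associated graph $\mathcal H$ has vertices the nonempty sets $[\bar v,\tilde v]$ and a directed edge from $[\bar v,\tilde v]$ to $[\bar v_1,\tilde v_1]$ iff $\sigma(\tilde v)=\bar v_1$ (loops allowed); $\mathcal H_n$ is a copy of $\mathcal H$ whose vertices are regarded as subsets of $V_n$. For $u\in V_{n+1}$, $w\in V_n$: $\tilde f^{(n)}_{u,w}=f^{(n)}_{u,w}-1$ if $\tilde e_u$ has source $w$, else $f^{(n)}_{u,w}$; $\bar f^{(n)}_{u,w}=f^{(n)}_{u,w}-1$ if $\bar e_u$ has source $w$, else $f^{(n)}_{u,w}$. Crossing number: $P_u([\bar v,\tilde v])=\sum_{w\in[\bar v,\tilde v]}\tilde f^{(n)}_{u,w}$. $\mathcal H_n$ is positively strongly connected if for each $u\in V_{n+1}$ the subgraph of $\mathcal H_n$ induced on the vertices $t$ with $P_u(t)>0$ is strongly connected. *)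

(* Defs.v *)
From HB Require Import structures.
From mathcomp Require Import all_boot.
Set Implicit Arguments. Unset Strict Implicit. Unset Printing Implicit Defensive.

(* Bratteli diagrams of strict rank: V_0 = {v0}, V_n = 'I_d for n >= 1.     *)
(*   h0 v        = number of edges from v0 to v in V_1       (= |E_1 ∩ r^-1 v|) *)
(*   mult n u w  = f^{(n)}_{u,w} = number of edges from w in V_n to u in     *)
(*                 V_{n+1}, for n >= 1 (mult 0 is unused junk).              *)
(* An edge of level n (element of E_n) is a triple (src, rng, idx):         *)
(*   level 1 : (None, v, k) with k < h0 v  (source v0)                       *)
(*   level n+1 (n>=1) : (Some w, u, k) with k < mult n u w.                  *)
Record bratteli := Bratteli {
  dim : nat;
  h0 : 'I_dim -> nat;
  mult : nat -> 'I_dim -> 'I_dim -> nat }.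

Definition edge (B : bratteli) := (option 'I_(dim B) * 'I_(dim B) * nat)%type.
Definition esrc B (e : edge B) : option 'I_(dim B) := e.1.1.
Definition erng B (e : edge B) : 'I_(dim B) := e.1.2.
Definition eidx B (e : edge B) : nat := e.2.

Definition inE (B : bratteli) (n : nat) (e : edge B) : Prop :=
  match n with
  | 0 => False
  | 1 => esrc e = None /\ eidx e < @h0 B (erng e)
  | n'.+1 => exists w, esrc e = Some w /\ eidx e < @mult B n' (erng e) w
  end.

Definition inR (B : bratteli) (n : nat) (v : 'I_(dim B)) (e : edge B) : Prop :=
  inE n e /\ erng e = v.

Definition strict_rank (B : bratteli) : Prop :=
  0 < dim B /\ (forall v : 'I_(dim B), 2 <= h0 v) /\
  (forall n v, 1 <= n -> 2 <= \sum_(w < dim B) @mult B n v w).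

Fixpoint conn (B : bratteli) (n : nat) (v : 'I_(dim B)) (k : nat) (w : 'I_(dim B))
  : Prop :=
  match k with
  | 0 => v = w
  | k'.+1 => exists u, conn n v k' u /\ 0 < @mult B (n + k') w u
  end.

(* simple (levels n >= 1; level 0 = {v0} is joined to everything anyway) *)
Definition simple (B : bratteli) : Prop :=
  forall n, 1 <= n -> exists k, 0 < k /\ forall v w : 'I_(dim B), conn n v k w.

(* Infinite paths: x k is the edge of level k+1. *)
Definition bpath (B : bratteli) (x : nat -> edge B) : Prop :=
  (forall k, inE k.+1 (x k)) /\ (forall k, esrc (x k.+1) = Some (erng (x k))).

Definition eqp (B : bratteli) (x y : nat -> edge B) : Prop := forall k, x k = y k.
Definition agree (B : bratteli) (x y : nat -> edge B) (N : nat) : Prop :=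
  forall k, k < N -> x k = y k.

Definition vertical_through (B : bratteli) (v : 'I_(dim B)) (x : nat -> edge B) : Prop :=
  bpath x /\ forall k, erng (x k) = v.

(* An ordering: a rank function, injective on each r^{-1}(v) at each level n, *)
(* representing a linear order on each r^{-1}(v).                           *)
Definition is_ordering (B : bratteli) (rk : nat -> edge B -> nat) : Prop :=
  forall n v e e', inR n v e -> inR n v e' -> rk n e = rk n e' -> e = e'.

Definition is_max (B : bratteli) (rk : nat -> edge B -> nat) n (e : edge B) : Prop :=
  forall e', inR n (erng e) e' -> rk n e' <= rk n e.
Definition is_min (B : bratteli) (rk : nat -> edge B -> nat) n (e : edge B) : Prop :=
  forall e', inR n (erng e) e' -> rk n e <= rk n e'.

Definition maxpath (B : bratteli) (rk : nat -> edge B -> nat) (x : nat -> edge B) : Prop :=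
  forall k, is_max rk k.+1 (x k).
Definition minpath (B : bratteli) (rk : nat -> edge B -> nat) (x : nat -> edge B) : Prop :=
  forall k, is_min rk k.+1 (x k).

Definition succ_edge (B : bratteli) (rk : nat -> edge B -> nat) n (e e' : edge B) : Prop :=
  inR n (erng e) e' /\ rk n e < rk n e' /\
  forall e'', inR n (erng e) e'' -> rk n e < rk n e'' -> rk n e' <= rk n e''.

(* phi is a Vershik map for the ordering rk: a homeomorphism of X_B          *)
(* (product topology of discrete edge sets), mapping maximal paths onto      *)
(* minimal paths, and acting on non-maximal paths by the Vershik rule.       *)
Definition vershik (B : bratteli) (rk : nat -> edge B -> nat)
  (phi : (nat -> edge B) -> (nat -> edge B)) : Prop :=
  (forall x, bpath x -> bpath (phi x)) /\
  (forall x y, bpath x -> bpath y -> eqp (phi x) (phi y) -> eqp x y) /\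
  (forall y, bpath y -> exists x, bpath x /\ eqp (phi x) y) /\
  (forall x N, bpath x -> exists M, forall y, bpath y ->
      agree x y M -> agree (phi x) (phi y) N) /\
  (forall x N, bpath x -> exists M, forall y, bpath y ->
      agree (phi x) (phi y) M -> agree x y N) /\
  (forall x, bpath x -> maxpath rk x -> minpath rk (phi x)) /\
  (forall y, bpath y -> minpath rk y ->
      exists x, bpath x /\ maxpath rk x /\ eqp (phi x) y) /\
  (forall x k, bpath x -> ~ is_max rk k.+1 (x k) ->
      (forall j, j < k -> is_max rk j.+1 (x j)) ->
      [/\ succ_edge rk k.+1 (x k) (phi x k),
          (forall j, k < j -> phi x j = x j) &
          (forall j, j < k -> is_min rk j.+1 (phi x j))]).

Definition perfect (B : bratteli) (rk : nat -> edge B -> nat) : Prop :=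
  exists phi, vershik rk phi.

(* Skeleton.  M v, m v : vertical paths; tv, bv : the maps w |-> ~v(w), -v(w); *)
(* te n w, be n w : the edges ~e_w, -e_w in r^{-1}(w), w in V_n, n >= 2.     *)
Definition is_skeleton (B : bratteli) (Vt Vb : {set 'I_(dim B)})
  (M m : 'I_(dim B) -> nat -> edge B) (tv bv : 'I_(dim B) -> 'I_(dim B))
  (te be : nat -> 'I_(dim B) -> edge B) : Prop :=
  #|Vt| = #|Vb| /\
  (forall v, v \in Vt -> vertical_through v (M v)) /\
  (forall v, v \in Vb -> vertical_through v (m v)) /\
  (forall v, v \in Vt -> v \in Vb -> forall k, M v k <> m v k) /\
  (forall w, tv w \in Vt) /\ (forall w, bv w \in Vb) /\
  (forall n w, 2 <= n ->
     inR n w (te n w) /\ inR n w (be n w) /\ te n w <> be n w /\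
     esrc (te n w) = Some (tv w) /\ esrc (be n w) = Some (bv w) /\
     (w \in Vt -> te n w = M w n.-1) /\
     (w \in Vb -> be n w = m w n.-1)).

Definition bij_on (d : nat) (sigma : 'I_d -> 'I_d) (Vt Vb : {set 'I_d}) : Prop :=
  (forall v, v \in Vt -> sigma v \in Vb) /\
  (forall u v, u \in Vt -> v \in Vt -> sigma u = sigma v -> u = v) /\
  (forall v, v \in Vb -> exists2 u, u \in Vt & sigma u = v).

Definition tildef (B : bratteli) (te : nat -> 'I_(dim B) -> edge B) n (u w : 'I_(dim B))
  : nat := @mult B n u w - (esrc (te n.+1 u) == Some w).
Definition barf (B : bratteli) (be : nat -> 'I_(dim B) -> edge B) n (u w : 'I_(dim B))
  : nat := @mult B n u w - (esrc (be n.+1 u) == Some w).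

(* A vertex of H is a pair p = (bar v, tilde v) with [bar v, tilde v] nonempty *)
Definition Hvert (B : bratteli) (Vt Vb : {set 'I_(dim B)})
  (tv bv : 'I_(dim B) -> 'I_(dim B)) (p : 'I_(dim B) * 'I_(dim B)) : bool :=
  [&& p.1 \in Vb, p.2 \in Vt & [exists w, (bv w == p.1) && (tv w == p.2)]].

Definition crossing (B : bratteli) (te : nat -> 'I_(dim B) -> edge B)
  (tv bv : 'I_(dim B) -> 'I_(dim B)) n (u : 'I_(dim B)) (p : 'I_(dim B) * 'I_(dim B))
  : nat := \sum_(w | (bv w == p.1) && (tv w == p.2)) tildef te n u w.

Definition pos_strongly_connected (B : bratteli) (Vt Vb : {set 'I_(dim B)})
  (tv bv : 'I_(dim B) -> 'I_(dim B)) (te : nat -> 'I_(dim B) -> edge B)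
  (sigma : 'I_(dim B) -> 'I_(dim B)) (n : nat) : Prop :=
  forall u : 'I_(dim B),
    let S := fun p => Hvert Vt Vb tv bv p && (0 < crossing te tv bv n u p) in
    forall p q, S p -> S q ->
      connect [rel a b | [&& S a, S b & sigma a.2 == b.1]] p q.

Definition balanced (B : bratteli) (Vt : {set 'I_(dim B)})
  (tv bv : 'I_(dim B) -> 'I_(dim B)) (te be : nat -> 'I_(dim B) -> edge B)
  (sigma : 'I_(dim B) -> 'I_(dim B)) (n : nat) : Prop :=
  forall u t, t \in Vt ->
    \sum_(w | tv w == t) tildef te n u w = \sum_(w | bv w == sigma t) barf be n u w.

(* Main.v *)
Require Import Defs.
From HB Require Import structures.
From mathcomp Require Import all_boot all_fingroup zify.
From Stdlib Require Classical_Prop ClassicalEpsilon.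
Set Implicit Arguments. Unset Strict Implicit. Unset Printing Implicit Defensive.

(** Regard an edge e of r^-1(u), with source w, as an arc from bv w to
    sigma (tv w).  The balance relations say that, te u being left out of the
    arrivals and be u out of the departures, these arcs form an Eulerian
    multigraph; positive strong connectivity makes it connected.  An Eulerian
    trail from be u to te u is a linear order on r^-1(u) in which an edge with
    source w is followed by one with source w' only if sigma (tv w) = bv w'.
    Hence a path that follows M_v for a long time is sent to one that follows
    m_(sigma v) for a long time, and conversely, so that the Vershik map is a
    homeomorphism.  By simplicity M_v is a limit of non-maximal paths, so every
    Vershik map sends M_v to m_(sigma v). *)

(** * Eulerian trails *)

Section Euler.
Variables (T : finType).

(** The i-th element of a fibre of [f] goes to the i-th element of the fibre of [g] over the same
    value. With heads for [f] and tails for [g], this assigns a successor to every arc. *)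
Lemma perm_of_fibres (V : eqType) (f g : T -> V) :
  (forall v, #|[pred x | f x == v]| = #|[pred x | g x == v]|) ->
  exists p : {perm T}, forall x, g (p x) = f x.
Proof.
move=> fg; pose F v := enum [pred x | f x == v]; pose G v := enum [pred x | g x == v].
have sFG v : size (F v) = size (G v) by rewrite -!cardE fg.
pose h x := nth x (G (f x)) (index x (F (f x))).
have xF x : x \in F (f x) by rewrite mem_enum inE.
have ltG x : index x (F (f x)) < size (G (f x)) by rewrite -sFG index_mem.
have gh x : g (h x) = f x.
  have: h x \in G (f x) by exact: mem_nth.
  by rewrite mem_enum inE => /eqP.
have h_inj : injective h.
  move=> x y hxy; have fxy : f x = f y by rewrite -!gh hxy.
  move: hxy; rewrite /h (set_nth_default y) //.
  rewrite fxy => /eqP; rewrite nth_uniq ?enum_uniq //; last by rewrite -fxy.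
  by move/eqP => /(congr1 (nth x (F (f y)))); rewrite !nth_index // -fxy.
by exists (perm h_inj) => x; rewrite permE.
Qed.

(** An arc [e] runs from [tau e] to [eta e]. A permutation sending each arc to one that may follow
    it splits the arcs into closed trails; with the fewest orbits possible, there is only one. The
    second hypothesis is connectedness, phrased through sets of arcs. *)
Lemma eulerian_trail (V : eqType) (tau eta : T -> V) (s t : T) :
  (forall v, #|[pred e | (e != t) && (eta e == v)]|
           = #|[pred e | (e != s) && (tau e == v)]|) ->
  (forall A : {set T}, s \in A ->
     (forall e f, e \in A -> e != t -> eta e = eta f \/ eta e = tau f -> f \in A) ->
     forall e, e != t -> e \in A) ->
  exists l, [/\ uniq (s :: l), forall e, e \in s :: l, last s l = t
              & path (fun a b => eta a == tau b) s l].
Proof.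
move=> bal conn.
pose good (p : {perm T}) := (p t == s) && [forall e, (e != t) ==> (eta e == tau (p e))].
(* Sending t back to s closes the trail up into a cycle. *)
have [p0 p0good] : exists p, good p.
  (* The value [None], taken only at [t] by one function and only at [s] by the other, forces
     [p t = s]. *)
  have [|p pP] := @perm_of_fibres (option V)
    (fun e => if e == t then None else Some (eta e))
    (fun e => if e == s then None else Some (tau e)).
    case=> [v|].
      rewrite (eq_card (B := [pred e | (e != t) && (eta e == v)])); last first.
        by move=> e; rewrite !inE; case: (e == t).
      by rewrite bal; apply: eq_card => e; rewrite !inE; case: (e == s).
    rewrite (eq_card (B := pred1 t)); last by move=> e; rewrite !inE; case: (e == t).
    rewrite [RHS](eq_card (B := pred1 s)) ?card1 //.
    by move=> e; rewrite !inE; case: (e == s).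
  exists p; apply/andP; split.
    by move: (pP t); rewrite eqxx; case: eqP.
  apply/forallP => e; apply/implyP => et.
  by move: (pP e); rewrite (negbTE et); case: ifP => // _ [->].
case: (arg_minnP (fun p => #|porbits p|) p0good) => p /andP[/eqP pt /forallP pn] pmin.
pose C := porbit p s.
have stepC x : (p x \in C) = (x \in C).
  by rewrite /C !(porbit_sym p _ s) (porbit_perm p 1 x).
have tC : t \in C by rewrite -stepC pt porbit_id.
(* Otherwise composing with the transposition of e and f would merge their
   orbits and lower the number of orbits. *)
have merge e f : e \in C -> e != t -> eta e = eta f -> f \in C.
  move=> eC et ef; apply: contraT => fC.
  have ft : f != t by apply: contraNneq fC => ->.
  have nef : e != f by apply: contraNneq fC => <-.
  have := pmin (tperm e f * p)%g.
  have -> : good (tperm e f * p)%g.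
    rewrite /good permM tpermD // pt eqxx /=.
    apply/forallP => g; apply/implyP => gt; rewrite permM.
    case: tpermP => [->|->|_ _]; last exact: (implyP (pn g)).
      by rewrite ef (implyP (pn f)).
    by rewrite -ef (implyP (pn e)).
  move=> /(_ isT); have := porbits_mul_tperm p e f.
  have -> : e \notin porbit p f.
    by rewrite porbit_sym; move: eC; rewrite /C -eq_porbit_mem => /eqP ->.
  rewrite nef /= => E; rewrite leqNgt; move/negP; case.
  by rewrite -(ltn_add2r 1) -E ltn_add2l.
have allC e : e \in C.
  have [->|et] := eqVneq e t; first exact: tC.
  apply: (conn C) => //; first exact: porbit_id.
  move=> {et}e f eC et [ef|ef]; first exact: merge ef.
  have [->|fs] := eqVneq f s; first exact: porbit_id.
  (* The predecessor of [f] under [p] ends where [f] starts, that is, where [e] ends, so [merge]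
     puts it in [C]. *)
  pose e' := (p^-1)%g f.
  have pe' : p e' = f by rewrite permKV.
  have e't : e' != t by apply: contraNneq fs => E; rewrite -pe' E pt.
  have e'C : e' \in C.
    by apply: (merge e) => //; rewrite ef -pe'; apply/esym/eqP/(implyP (pn e')).
  by rewrite -pe' stepC.
have tr := porbit_traject p s; have us := uniq_traject_porbit p s.
have Cgt : 0 < #|porbit p s| by rewrite (cardD1 s) porbit_id.
move: tr us; case E: #|porbit p s| Cgt => [//|k] _ /= tr us.
exists (traject p (p s) k); split=> //.
- by move=> e; rewrite -trajectS; move: (allC e); rewrite /C tr.
- by apply: (@perm_inj _ p); rewrite last_traject pt -iterS -E iter_porbit.
have Hl : iter k p s = t.
  by apply: (@perm_inj _ p); rewrite pt -iterS -E iter_porbit.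
apply/(pathP s) => i; rewrite size_traject => ik.
have nthE j : j <= k -> nth s (s :: traject p (p s) k) j = iter j p s.
  by move=> jk; exact: (@nth_traject _ p j k.+1).
rewrite -[nth s (traject _ _ _) i]/(nth s (s :: traject p (p s) k) i.+1).
rewrite !nthE ?(ltnW ik) // iterS; apply: (implyP (pn _)).
rewrite -Hl -!nthE ?(ltnW ik) // nth_uniq //= ?size_traject ?ltnS ?(ltnW ik) //.
by rewrite neq_ltn ik.
Qed.
End Euler.

(** Edges carry an index in [nat] and form an infinite type; the finite type [seq_sub E] holds the
    arcs actually present. *)
Lemma eulerian_trail_seq (T : choiceType) (V : eqType) (E : seq T)
    (tau eta : T -> V) (s t : T) :
  uniq E -> s \in E -> t \in E ->
  (forall v, count (fun e => (e != t) && (eta e == v)) E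
           = count (fun e => (e != s) && (tau e == v)) E) ->
  (forall A : pred T, A s ->
     (forall e f, e \in E -> f \in E -> A e -> e != t ->
        eta e = eta f \/ eta e = tau f -> A f) ->
     forall e, e \in E -> e != t -> A e) ->
  exists l, [/\ perm_eq (s :: l) E, last s l = t
              & path (fun a b => eta a == tau b) s l].
Proof.
move=> uE sE tE bal conn.
pose S : finType := seq_sub E.
have cardS (P : pred T) : #|[pred e : S | P (val e)]| = count P E.
  rewrite cardE -size_filter -(size_map val); apply/perm_size/uniq_perm.
  - by rewrite map_inj_uniq ?enum_uniq //; exact: val_inj.
  - exact: filter_uniq.
  move=> x; rewrite mem_filter; apply/mapP/andP.
    by case=> y; rewrite mem_enum inE => Py ->; split=> //; exact: (valP y).
  by case=> Px xE; exists (SeqSub xE) => //; rewrite mem_enum inE.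
have [||l [ul al ll pl]] :=
    @eulerian_trail S V (tau \o val) (eta \o val) (SeqSub sE) (SeqSub tE).
- move=> v; rewrite (cardS (fun e => (e != t) && (eta e == v))).
  by rewrite (cardS (fun e => (e != s) && (tau e == v))).
- move=> A sA clA e et.
  pose A' x := if (insub x : option S) is Some y then y \in A else false.
  have : A' (val e).
    apply: conn (valP e) et; first by rewrite /A' insubT.
    move=> a b aE bE; rewrite /A' !insubT => aA at' ab.
    exact: (clA _ (SeqSub bE) aA).
  by rewrite /A' valK.
exists (map val l); split.
- apply: uniq_perm => //; first by rewrite -[_ :: _]/(map val (SeqSub sE :: l)) (map_inj_uniq val_inj).
  move=> x; apply/(mapP (s := SeqSub sE :: l))/idP => [[y _ ->]|xE].
    exact: (valP y).
  by exists (SeqSub xE).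
- by rewrite (last_map val l (SeqSub sE)) ll.
- have := @path_map _ _ val (fun a b => eta a == tau b) (SeqSub sE) l.
  by move=> /= ->.
Qed.

(** * Paths and extremal edges *)

Section Paths.
Variable B : bratteli.
Implicit Types (x y z : nat -> edge B) (e f : edge B) (v w u : 'I_(dim B)).

(** A finite path with [K] edges, kept as an infinite sequence with arbitrary entries from [K] on,
    so that it can be glued to a path. *)
Definition prepath K x : Prop :=
  (forall k, k < K -> Defs.inE k.+1 (x k)) /\
  (forall k, k.+1 < K -> esrc (x k.+1) = Some (erng (x k))).

Definition glue K y z : nat -> edge B := fun j => if j < K then y j else z j.

Lemma bpath_prepath K x : bpath x -> prepath K x.
Proof. by case=> xE xs; split=> k _. Qed.

Lemma prepath_glue K y e : prepath K.+1 y -> Defs.inE K.+2 e -> esrc e = Some (erng (y K)) ->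
  prepath K.+2 (glue K.+1 y (fun=> e)).
Proof.
move=> [yE ys] eE es; split=> k kK; rewrite /glue.
  by case: ifP => k1; [exact: yE | have -> : k = K.+1 by lia].
case: ifP => k1; first by rewrite ifT ?ys //; lia.
by (have -> : k = K by lia); rewrite ltnSn.
Qed.

Lemma bpath_glue K y z : prepath K.+1 y -> bpath z -> erng (y K) = erng (z K) ->
  bpath (glue K.+1 y z).
Proof.
move=> [yE ys] [zE zs] yz; split=> k; rewrite /glue.
  by case: ifP => kK; [exact: yE | exact: zE].
case: ifP => kK; first by rewrite ifT ?ys //; lia.
case: ifP => kK'; last exact: zs.
by (have -> : k = K by lia); rewrite zs yz.
Qed.

Lemma inE_src n e : Defs.inE n.+2 e -> exists w, esrc e = Some w.
Proof. by case=> w [-> _]; exists w. Qed.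

(** The added edges may all have index 0, the multiplicities being positive. The edge [x n] ends at
    level [n.+1], hence the shift in [conn]. *)
Lemma conn_path x n v k w : bpath x -> erng (x n) = v -> conn n.+1 v k w ->
  exists y, [/\ prepath (n + k).+1 y, agree y x n.+1 & erng (y (n + k)) = w].
Proof.
move=> xb xv; elim: k w => [w /= <-|k IH w /= [u [/IH[y [py ya yu]] mu]]].
  by exists x; rewrite addn0; split=> //; exact: bpath_prepath.
exists (glue (n + k).+1 y (fun=> (Some u, w, 0))); split.
- rewrite addnS; apply: prepath_glue => //; last by rewrite yu.
  by exists u.
- by move=> j jn; rewrite /glue ifT ?ya //; lia.
- by rewrite /glue ifF //; lia.
Qed.

(** The common shape of the maximal and of the minimal edges. The fixed points of [tv] are the
    vertices that carry a vertical extremal path. Edges of level 1 start at v0, so sources are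
    prescribed from level 2 on. *)
Definition extremal_family (mx : nat -> 'I_(dim B) -> edge B) (tv : 'I_(dim B) -> 'I_(dim B)) :=
  [/\ forall n v, inR n.+1 v (mx n.+1 v),
      forall n v, esrc (mx n.+2 v) = Some (tv v)
    & forall v, tv (tv v) = tv v].

Section Down.
Variables (mx : nat -> 'I_(dim B) -> edge B) (tv : 'I_(dim B) -> 'I_(dim B)).
Hypothesis mxP : extremal_family mx tv.

(** The family supplies the edges one by one, going down from the source of [e]. This is the initial
    segment that the Vershik rule puts below a successor edge. *)
Lemma extremal_down k e : Defs.inE k.+1 e ->
  exists y, [/\ prepath k.+1 y, y k = e & forall j, j < k -> y j = mx j.+1 (erng (y j))].
Proof.
case: mxP => mxR _ _; elim: k e => [|k IH] e eE.
  exists (fun=> e); split=> //; split=> j //; rewrite ltnS leqn0 => /eqP-> //.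
case: (inE_src eE) => w ew; have [mE mw] := mxR k w.
have [y [py yk ym]] := IH _ mE.
exists (glue k.+1 y (fun=> e)); split.
- by apply: prepath_glue => //; rewrite yk mw.
- by rewrite /glue ltnn.
move=> j jk; rewrite /glue jk; have [|kj] := ltnP j k; first exact: ym.
by (have -> : j = k by lia); rewrite yk mw.
Qed.

Lemma extremal_down_unique k x y : bpath x -> bpath y -> x k = y k ->
  (forall j, j < k -> x j = mx j.+1 (erng (x j))) ->
  (forall j, j < k -> y j = mx j.+1 (erng (y j))) -> agree x y k.+1.
Proof.
move=> [_ xs] [_ ys]; elim: k => [|k IH] xyk xm ym.
  by move=> j; rewrite ltnS leqn0 => /eqP->.
move=> j; rewrite ltnS leq_eqVlt => /orP[/eqP->//|]; move: j; apply: IH.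
- rewrite xm // ym //; congr (mx _ _).
  by apply/Some_inj; rewrite -xs -ys xyk.
- by move=> j jk; apply: xm; lia.
- by move=> j jk; apply: ym; lia.
Qed.

(** Each vertex of [x] is [tv] of the next one; so all are fixed by [tv], and consecutive ones
    coincide. *)
Lemma extremal_vertical x v : bpath x -> (forall k, x k = mx k.+1 (erng (x k))) ->
  erng (x 0) = v -> tv v = v /\ forall k, x k = mx k.+1 v.
Proof.
case: mxP => mxR mxs tvK [_ xs] xm x0.
have st k : tv (erng (x k.+1)) = erng (x k).
  by apply/Some_inj; rewrite -xs [in RHS]xm mxs.
have fx k : tv (erng (x k)) = erng (x k) by rewrite -st tvK.
have xv k : erng (x k) = v by elim: k => // k <-; rewrite -(st k) fx.
by split=> [|k]; [rewrite -x0 fx | rewrite xm xv].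
Qed.

(* If the edges of x are extremal up to level k and x passes through w at
   level k, then x is, up to level k - 1, the vertical path through tv w. *)
Lemma extremal_prefix x k w : bpath x -> esrc (x k) = Some w ->
  (forall j, j < k -> x j = mx j.+1 (erng (x j))) ->
  forall j, j.+1 < k -> x j = mx j.+1 (tv w).
Proof.
case: mxP => mxR mxs tvK [_ xs] xw xm.
case: k xw xm => [//|k] xw xm.
have kw : erng (x k) = w by apply/Some_inj; rewrite -xs.
(* Downward induction: the first extremal edge leads from [w] to [tv w], and [tv] fixes that vertex
   from there on. *)
have H i : i < k -> erng (x (k - i.+1)) = tv w.
  elim: i => [|i IH] ik; apply/Some_inj; rewrite -xs.
    have -> : (k - 1).+1 = k by lia.
    have Ek : k = k.-1.+1 by lia.
    by rewrite (xm k) // kw Ek mxs.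
  have -> : (k - i.+2).+1 = k - i.+1 by lia.
  rewrite xm ?IH; try lia.
  have -> : (k - i.+1).+1 = (k - i.+2).+2 by lia.
  by rewrite mxs tvK.
move=> j jk; rewrite xm; last by lia.
have := H (k - j.+1); have -> : k - (k - j.+1).+1 = j by lia.
by move=> -> //; lia.
Qed.
End Down.

(* The two halves of a Vershik map (on paths and on their images) are
   exchanged by reversing every order: the hypotheses below are stable under
   swapping (mx, tv) with (mn, bv) and transposing succ and sg, so each lemma
   of this section is used for the map and for its inverse. *)
Section Half.
Variables (mx mn : nat -> 'I_(dim B) -> edge B).
Variable succ : nat -> edge B -> edge B -> Prop.
Variables (tv bv : 'I_(dim B) -> 'I_(dim B)).
Variable sg : 'I_(dim B) -> 'I_(dim B) -> Prop.
Variable N : nat.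
Hypothesis mxP : extremal_family mx tv.
Hypothesis mnP : extremal_family mn bv.
Hypothesis succP : forall n e f, succ n e f ->
  [/\ Defs.inE n e, Defs.inE n f, erng e = erng f, e <> mx n (erng e) & f <> mn n (erng f)].
Hypothesis succ_ex : forall n e, Defs.inE n e -> e <> mx n (erng e) -> exists f, succ n e f.
Hypothesis succ_fun : forall n e f f', succ n e f -> succ n e f' -> f = f'.
Hypothesis sg_ex : forall v, tv v = v -> exists2 b, bv b = b & sg v b.
Hypothesis sg_fun : forall v b b', sg v b -> sg v b' -> b = b'.
Hypothesis compat : forall n e f w u, N < n -> succ n e f ->
  esrc e = Some w -> esrc f = Some u -> sg (tv w) (bv u).

(** A relation rather than a function: its converse has the same form with maxima and minima
    exchanged, which gives the inverse map without a second construction. *)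
Definition vrel x y : Prop :=
  (exists v b, [/\ tv v = v, bv b = b, sg v b,
     forall k, x k = mx k.+1 v & forall k, y k = mn k.+1 b]) \/
  (exists k, [/\ forall j, j < k -> x j = mx j.+1 (erng (x j)),
     succ k.+1 (x k) (y k), forall j, k < j -> y j = x j
   & forall j, j < k -> y j = mn j.+1 (erng (y j))]).

Lemma vertical_extremal (m' : nat -> 'I_(dim B) -> edge B) t' v : extremal_family m' t' ->
  t' v = v -> bpath (fun k => m' k.+1 v).
Proof.
by case=> mR ms _ tvv; split=> k; [case: (mR k v) | rewrite ms tvv; case: (mR k v) => _ ->].
Qed.

Lemma ex_first_nonextremal x : ~ (forall k, x k = mx k.+1 (erng (x k))) ->
  exists2 k, x k <> mx k.+1 (erng (x k)) & forall j, j < k -> x j = mx j.+1 (erng (x j)).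
Proof.
move=> nall; have ex : exists k, x k != mx k.+1 (erng (x k)).
  apply: Classical_Prop.NNPP => nex; apply: nall => k.
  by apply/eqP; apply: contra_notT nex; exists k.
case: (ex_minnP ex) => k /eqP xk kmin; exists k => // j jk.
by apply/eqP; apply: contraTT jk => /kmin; rewrite -leqNgt.
Qed.

Lemma vrel_ex x : bpath x -> exists2 y, bpath y & vrel x y.
Proof.
move=> xb.
have [xm|/ex_first_nonextremal[k xk km]] :=
  Classical_Prop.classic (forall k, x k = mx k.+1 (erng (x k))).
  have [tvv xv] := extremal_vertical mxP xb xm erefl.
  have [b bb sb] := sg_ex tvv.
  exists (fun k => mn k.+1 b); first exact: (vertical_extremal mnP).
  by left; exists (erng (x 0)), b.
have [f xf] := succ_ex (xb.1 k) xk; have [_ fE ef _ _] := succP xf.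
have [y [py yk ym]] := extremal_down mnP fE.
exists (glue k.+1 y x); first by apply: bpath_glue => //; rewrite yk ef.
right; exists k; rewrite /glue; split=> //.
- by rewrite ltnSn yk.
- by move=> j kj; rewrite ifF //; lia.
- by move=> j kj; rewrite ifT; [exact: ym | lia].
Qed.

(** Let [w] and [u] be the sources of [x k] and [y k]. By [extremal_prefix] the paths below are
    vertical through [tv w] and [bv u], which [compat] relates. The bound [1 < k] makes [x 0] part
    of the vertical stretch, so that [v = tv w]. *)
Lemma vrel_vertical_limit x y k v : bpath x -> bpath y ->
  (forall j, j < k -> x j = mx j.+1 (erng (x j))) ->
  succ k.+1 (x k) (y k) ->
  (forall j, j < k -> y j = mn j.+1 (erng (y j))) ->
  1 < k -> N <= k -> erng (x 0) = v ->
  exists2 b, sg v b & forall j, j.+1 < k -> y j = mn j.+1 b.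
Proof.
move=> xb yb xm xy ym k1 Nk x0.
case: k k1 Nk xm xy ym => [//|k] k1 Nk xm xy ym.
have [w xw] := inE_src (xb.1 k.+1); have [u yu] := inE_src (yb.1 k.+1).
exists (bv u); last exact: (extremal_prefix mnP).
have <- : tv w = v.
  by rewrite -x0 (extremal_prefix mxP xb xw xm k1); case: mxP => /(_ 0 (tv w))[_ ->].
exact: compat xy xw yu.
Qed.

(** Near an extremal path, a path is either that path or extremal for many levels, and
    [vrel_vertical_limit] applies. Near any other path, the first non-extremal edge is the same, and
    with it the successor and the segment below. *)
Lemma vrel_continuous x y K : bpath x -> bpath y -> vrel x y ->
  exists L, forall x' y', bpath x' -> bpath y' -> vrel x' y' ->
    agree x x' L -> agree y y' K.
Proof.
move=> xb yb [[v [b [tvv bb vb xv yv]]]|[k [xm xy yj ym]]].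
- have x0 : erng (x 0) = v by rewrite xv; case: mxP => /(_ 0 v)[_ ->].
  (* Here [N] makes [compat] applicable, [K] is the agreement wanted, and 2 ensures [1 < k']. *)
  exists (N + K + 2) => x' y' x'b y'b xy0 a.
  have x'0 : erng (x' 0) = v by rewrite -a ?x0 //; lia.
  case: xy0 => [[v' [b' [_ _ vb' xv' yv']]]|[k' [xm' xy' yj' ym']]].
    have E : v' = v by rewrite -x'0 xv'; case: mxP => /(_ 0 v')[_ ->].
    by move=> j _; rewrite yv yv'; rewrite E in vb'; rewrite (sg_fun vb vb').
  have kL : N + K + 2 <= k'.
    rewrite leqNgt; apply/negP => kL; have [_ _ _ nm _] := succP xy'.
    apply: nm; rewrite -a // xv; congr mx.
    by case: mxP => mR _ _; case: (mR k' v).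
  have [||b' vb' yb'] := vrel_vertical_limit x'b y'b xm' xy' ym' _ _ x'0; try lia.
  by move=> j jK; rewrite yv yb' ?(sg_fun vb vb') //; lia.
have [_ _ _ xnm ynm] := succP xy.
(* This covers the first non-extremal edge [x k] and all entries below [K]. *)
exists (k.+1 + K) => x' y' x'b y'b xy0 a.
have ak : x' k = x k by rewrite a //; lia.
case: xy0 => [[v' [b' [_ _ _ xv' _]]]|[k' [xm' xy' yj' ym']]].
  case: xnm; rewrite -ak xv'; congr mx.
  by case: mxP => mR _ _; case: (mR k v').
have [_ _ _ xnm' _] := succP xy'.
have E : k' = k.
  case: (ltngtP k' k) => // kk.
    by case: xnm'; rewrite -a; [exact: xm | lia].
  by case: xnm; rewrite -ak; exact: xm'.
rewrite {}E in xm' xy' yj' ym' xnm' *.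
rewrite ak in xy'; have yk := succ_fun xy xy'.
move=> j jK; have [jk|kj] := leqP j k.
  exact: (extremal_down_unique yb y'b yk ym ym').
by rewrite yj // yj' // a //; lia.
Qed.
End Half.
End Paths.

(** * Orders given by lists and their Vershik maps *)

Section Ordering.
Variable B : bratteli.
Variables (mx mn : nat -> 'I_(dim B) -> edge B).
Variable L : nat -> 'I_(dim B) -> seq (edge B).
Hypothesis L_uniq : forall n v, uniq (L n.+1 v).
Hypothesis mem_L : forall n v e, e \in L n.+1 v <-> inR n.+1 v e.
Hypothesis L_mn : forall n v, exists l, L n.+1 v = mn n.+1 v :: l.
Hypothesis L_mx : forall n v, exists l, L n.+1 v = rcons l (mx n.+1 v).

Definition list_rank n (e : edge B) := index e (L n (erng e)).
Local Notation rk := list_rank.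

(** Unlike [succ_edge], this form turns into the predecessor relation by mere transposition, as the
    inverse map requires. *)
Definition next_edge n (e f : edge B) :=
  [/\ Defs.inE n e, inR n (erng e) f & rk n f = (rk n e).+1].

Lemma list_rank_inj n v e f : inR n v e -> inR n v f -> rk n e = rk n f -> e = f.
Proof.
case: n => [[]//|n] eR fR; rewrite /rk (proj2 eR) (proj2 fR).
by apply: (index_inj e); apply/mem_L.
Qed.

Lemma list_rank_mn n v : inR n.+1 v (mn n.+1 v) /\ rk n.+1 (mn n.+1 v) = 0.
Proof.
have [l El] := L_mn n v; have mR : inR n.+1 v (mn n.+1 v).
  by apply/mem_L; rewrite El mem_head.
by split=> //; rewrite /rk (proj2 mR) El /= eqxx.
Qed.

Lemma list_rank_mx n v : inR n.+1 v (mx n.+1 v) /\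
  rk n.+1 (mx n.+1 v) = (size (L n.+1 v)).-1.
Proof.
have [l El] := L_mx n v; have mR : inR n.+1 v (mx n.+1 v).
  by apply/mem_L; rewrite El mem_rcons mem_head.
split=> //; rewrite /rk (proj2 mR) El size_rcons.
have := L_uniq n v; rewrite El rcons_uniq => /andP[ml _].
by rewrite -cats1 index_cat (negbTE ml) /= eqxx addn0.
Qed.

Lemma list_rank_lt n v e : inR n.+1 v e -> rk n.+1 e < size (L n.+1 v).
Proof. by move=> eR; rewrite /rk (proj2 eR) index_mem; apply/mem_L. Qed.

Lemma nth_list_rank n v i e0 : i < size (L n.+1 v) ->
  inR n.+1 v (nth e0 (L n.+1 v) i) /\ rk n.+1 (nth e0 (L n.+1 v) i) = i.
Proof.
move=> iL; have fR : inR n.+1 v (nth e0 (L n.+1 v) i) by apply/mem_L/mem_nth.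
by split=> //; rewrite /rk (proj2 fR) index_uniq.
Qed.

Lemma is_max_list_rank n e : Defs.inE n.+1 e ->
  is_max rk n.+1 e <-> e = mx n.+1 (erng e).
Proof.
move=> eE; have [mR mk] := list_rank_mx n (erng e).
have le_m f : inR n.+1 (erng e) f -> rk n.+1 f <= rk n.+1 (mx n.+1 (erng e)).
  by move=> /list_rank_lt; rewrite mk; lia.
split=> [emax|-> f]; last by rewrite (proj2 mR); exact: le_m.
apply: (@list_rank_inj n.+1 (erng e)) => //; apply/eqP.
by rewrite eqn_leq le_m // emax.
Qed.

Lemma is_min_list_rank n e : Defs.inE n.+1 e ->
  is_min rk n.+1 e <-> e = mn n.+1 (erng e).
Proof.
move=> eE; have [mR mk] := list_rank_mn n (erng e).
split=> [emin|-> f _]; last by rewrite mk.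
apply: (@list_rank_inj n.+1 (erng e)) => //; apply/eqP.
by rewrite eqn_leq emin // mk.
Qed.

(** Ranks in a list have no gaps, so the least larger rank is the next integer. *)
Lemma succ_edge_list_rank n e f : Defs.inE n.+1 e ->
  succ_edge rk n.+1 e f <-> next_edge n.+1 e f.
Proof.
move=> eE; split=> [[fR [ef fmin]]|[_ fR ef]]; split=> //.
  have fl := list_rank_lt fR.
  have il : (rk n.+1 e).+1 < size (L n.+1 (erng e)) by lia.
  have [gR gk] := nth_list_rank e il.
  by have := fmin _ gR; rewrite gk => /(_ (leqnn _)); lia.
by split=> [|g _]; rewrite ef.
Qed.

Lemma next_edgeP n e f : next_edge n.+1 e f ->
  [/\ Defs.inE n.+1 e, Defs.inE n.+1 f, erng e = erng f,
      e <> mx n.+1 (erng e) & f <> mn n.+1 (erng f)].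
Proof.
move=> [eE fR ef]; have [fE fv] := fR; split=> // E.
  have := list_rank_lt fR; rewrite ef E.
  by have [mR ->] := list_rank_mx n (erng e); rewrite (proj2 mR); lia.
by move: ef; rewrite E; have [_ ->] := list_rank_mn n (erng f).
Qed.

Lemma next_edge_fun n e f f' : next_edge n.+1 e f -> next_edge n.+1 e f' -> f = f'.
Proof. by move=> [_ fR ef] [_ fR' ef']; apply: list_rank_inj fR fR' _; rewrite ef. Qed.

Lemma next_edge_inj n e e' f : next_edge n.+1 e f -> next_edge n.+1 e' f -> e = e'.
Proof.
move=> [eE fR ef] [eE' fR' ef'].
have ee : erng e' = erng e by rewrite -(proj2 fR') (proj2 fR).
by apply: (@list_rank_inj n.+1 (erng e)); [| |apply: succn_inj; rewrite -ef -ef'].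
Qed.

Lemma next_edge_ex n e : Defs.inE n.+1 e -> e <> mx n.+1 (erng e) ->
  exists f, next_edge n.+1 e f.
Proof.
move=> eE em; have [mR mk] := list_rank_mx n (erng e).
have el := @list_rank_lt n (erng e) e (conj eE erefl).
have nk : rk n.+1 e != (size (L n.+1 (erng e))).-1.
  apply/eqP => E; apply: em; apply: (@list_rank_inj n.+1 (erng e)) => //.
  by rewrite mk.
have il : (rk n.+1 e).+1 < size (L n.+1 (erng e)) by lia.
by have [gR gk] := nth_list_rank e il; exists (nth e (L n.+1 (erng e)) (rk n.+1 e).+1).
Qed.

Lemma prev_edge_ex n f : Defs.inE n.+1 f -> f <> mn n.+1 (erng f) ->
  exists e, next_edge n.+1 e f.
Proof.
move=> fE fm; have [mR mk] := list_rank_mn n (erng f).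
have fl := @list_rank_lt n (erng f) f (conj fE erefl).
have nk : rk n.+1 f != 0.
  apply/eqP => E; apply: fm; apply: (@list_rank_inj n.+1 (erng f)) => //.
  by rewrite mk.
have il : (rk n.+1 f).-1 < size (L n.+1 (erng f)) by lia.
have [gR gk] := nth_list_rank f il.
exists (nth f (L n.+1 (erng f)) (rk n.+1 f).-1); split; first exact: (proj1 gR).
  by rewrite (proj2 gR).
by rewrite gk; lia.
Qed.

(** The relation [r] need not be transitive; [sorted] speaks of neighbours in the list. This is how
    the trail condition reaches successor edges. *)
Lemma next_edge_sorted (r : rel (edge B)) n e f :
  sorted r (L n.+1 (erng e)) -> next_edge n.+1 e f -> r e f.
Proof.
move=> /(sortedP e) srt [eE fR ef].
have fl := list_rank_lt fR; rewrite ef in fl.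
have := srt _ fl; rewrite -ef /rk (proj2 fR).
by rewrite !nth_index //; apply/mem_L.
Qed.

(** * The Vershik map of an order given by lists *)

Section Vershik.
Variables (tv bv : 'I_(dim B) -> 'I_(dim B)) (sg : 'I_(dim B) -> 'I_(dim B) -> Prop) (N : nat).
Hypothesis mxP : extremal_family mx tv.
Hypothesis mnP : extremal_family mn bv.
Hypothesis sg_ex : forall v, tv v = v -> exists2 b, bv b = b & sg v b.
Hypothesis sg_xe : forall b, bv b = b -> exists2 v, tv v = v & sg v b.
Hypothesis sg_fun : forall v b b', sg v b -> sg v b' -> b = b'.
Hypothesis sg_inj : forall v v' b, sg v b -> sg v' b -> v = v'.
Hypothesis compat : forall n e f w u, N < n -> next_edge n e f ->
  esrc e = Some w -> esrc f = Some u -> sg (tv w) (bv u).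

Local Notation R := (vrel mx mn next_edge tv bv sg).
Local Notation R' := (vrel mn mx (fun n f e => next_edge n e f) bv tv (fun b v => sg v b)).

Lemma vrel_sym x y : R x y -> R' y x.
Proof.
case=> [[v [b [vv bb vb xv yv]]]|[k [xm xy yj ym]]]; [left|right].
  by exists b, v.
by exists k; split=> // j /yj.
Qed.
Lemma vrel_sym' x y : R' y x -> R x y.
Proof.
case=> [[v [b [vv bb vb xv yv]]]|[k [xm xy yj ym]]]; [left|right].
  by exists b, v.
by exists k; split=> // j /yj.
Qed.

Lemma maxpath_list_rank x : bpath x ->
  maxpath rk x <-> forall k, x k = mx k.+1 (erng (x k)).
Proof. by move=> xb; split=> xm k; apply/is_max_list_rank; try exact: xb.1. Qed.

Lemma minpath_list_rank x : bpath x ->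
  minpath rk x <-> forall k, x k = mn k.+1 (erng (x k)).
Proof. by move=> xb; split=> xm k; apply/is_min_list_rank; try exact: xb.1. Qed.

Let nextP n e f : next_edge n e f ->
  [/\ Defs.inE n e, Defs.inE n f, erng e = erng f,
      e <> mx n (erng e) & f <> mn n (erng f)].
Proof. by case: n => [[[]]|n]; exact: next_edgeP. Qed.

Let next_fun n e f f' : next_edge n e f -> next_edge n e f' -> f = f'.
Proof. by case: n => [[[]]|n]; exact: next_edge_fun. Qed.

Let next_ex n e : Defs.inE n e -> e <> mx n (erng e) -> exists f, next_edge n e f.
Proof. by case: n => [[]|n]; exact: next_edge_ex. Qed.

Let prevP n f e : next_edge n e f ->
  [/\ Defs.inE n f, Defs.inE n e, erng f = erng e,
      f <> mn n (erng f) & e <> mx n (erng e)].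
Proof. by move=> /nextP[]. Qed.

Let prev_fun n f e e' : next_edge n e f -> next_edge n e' f -> e = e'.
Proof. by case: n => [[[]]|n]; exact: next_edge_inj. Qed.

Let prev_ex n f : Defs.inE n f -> f <> mn n (erng f) -> exists e, next_edge n e f.
Proof. by case: n => [[]|n]; exact: prev_edge_ex. Qed.

Let compat' n f e u w : N < n -> next_edge n e f ->
  esrc f = Some u -> esrc e = Some w -> sg (tv w) (bv u).
Proof. by move=> Nn ef fu ew; exact: compat Nn ef ew fu. Qed.

Let R_ex x : bpath x -> exists2 y, bpath y & R x y.
Proof. exact: vrel_ex. Qed.

Let R_xe y : bpath y -> exists2 x, bpath x & R x y.
Proof.
move=> yb; have [x xb xy] := vrel_ex mnP mxP prevP prev_ex sg_xe yb.
by exists x => //; exact: vrel_sym'.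
Qed.

Let R_cont x y K : bpath x -> bpath y -> R x y ->
  exists L, forall x' y', bpath x' -> bpath y' -> R x' y' -> agree x x' L -> agree y y' K.
Proof. exact: (vrel_continuous mxP mnP nextP next_fun sg_fun compat). Qed.

Let R_tnoc x y K : bpath x -> bpath y -> R x y ->
  exists L, forall x' y', bpath x' -> bpath y' -> R x' y' -> agree y y' L -> agree x x' K.
Proof.
move=> xb yb /vrel_sym xy.
have sgi b v v' : sg v b -> sg v' b -> v = v' by exact: sg_inj.
have [l Hl] := vrel_continuous mnP mxP prevP prev_fun sgi compat' K yb xb xy.
by exists l => x' y' xb' yb' /vrel_sym; exact: Hl.
Qed.

(** The map picks an image under [R], with a junk value off the path space. Continuity of [R] in
    both directions yields the homeomorphism, and also uniqueness of images and injectivity. *)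
Lemma list_rank_perfect : perfect rk.
Proof.
have ch x : {y | bpath x -> bpath y /\ R x y}.
  apply: ClassicalEpsilon.constructive_indefinite_description.
  have [xb|nb] := Classical_Prop.classic (bpath x); last by exists x.
  by have [y yb xy] := R_ex xb; exists y.
pose phi x := sval (ch x).
have phib x : bpath x -> bpath (phi x) by move=> xb; case: (svalP (ch x) xb).
have phiR x : bpath x -> R x (phi x) by move=> xb; case: (svalP (ch x) xb).
have phiV x K : bpath x -> exists M, forall y, bpath y ->
    agree (phi x) (phi y) M -> agree x y K.
  move=> xb; have [l Hl] := R_tnoc K xb (phib _ xb) (phiR _ xb).
  by exists l => y yb; apply: Hl; auto.
have phiC x K : bpath x -> exists M, forall y, bpath y ->
    agree x y M -> agree (phi x) (phi y) K.
  move=> xb; have [l Hl] := R_cont K xb (phib _ xb) (phiR _ xb).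
  by exists l => y yb; apply: Hl; auto.
(* Continuity at [x], tested on [x] itself, shows that images are unique. *)
have Rphi x y : bpath x -> bpath y -> R x y -> eqp (phi x) y.
  move=> xb yb xy k; have [l Hl] := R_cont k.+1 xb (phib _ xb) (phiR _ xb).
  exact: (Hl x y).
exists phi; split=> //; split; [|split; [|split; [|split; [|split; [|split]]]]] => //.
(* Equal images agree to every depth, so continuity of the inverse gives equal paths. *)
- move=> x y xb yb xy k; have [l Hl] := phiV x k.+1 xb.
  by apply: (Hl y yb) => // j _; exact: xy.
- move=> y yb; have [x xb xy] := R_xe yb.
  by exists x; split=> //; exact: Rphi.
- move=> x xb /(maxpath_list_rank xb) xm; apply/(minpath_list_rank (phib x xb)).
  have [[v [b [_ _ _ _ yv]]]|[k [_ xy _ _]]] := phiR x xb.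
    by move=> k; rewrite yv; have [mR _] := list_rank_mn k b; rewrite (proj2 mR).
  by have [_ _ _] := nextP xy; rewrite -xm.
- move=> y yb /(minpath_list_rank yb) ym; have [x xb xy] := R_xe yb.
  exists x; split=> //; split; last exact: Rphi.
  apply/(maxpath_list_rank xb).
  case: xy => [[v [b [_ _ _ xv _]]]|[k [_ xy _ _]]].
    by move=> k; rewrite xv; have [mR _] := list_rank_mx k v; rewrite (proj2 mR).
  by have [_ _ _ _] := nextP xy; rewrite -ym.
move=> x k xb xk xm.
have nxk : x k <> mx k.+1 (erng (x k)) by move/(is_max_list_rank (xb.1 k)).
have {}xm j : j < k -> x j = mx j.+1 (erng (x j)).
  by move/xm/(is_max_list_rank (xb.1 j)).
have [[v [b [_ _ _ xv _]]]|[k' [xm' xy yj ym]]] := phiR x xb.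
  by case: nxk; rewrite xv; have [mR _] := list_rank_mx k v; rewrite (proj2 mR).
have E : k' = k.
  case: (ltngtP k' k) => // kk; last by case: nxk; exact: xm'.
  by have [_ _ _] := nextP xy; rewrite -xm.
rewrite {}E in xy yj ym *; split=> //.
  by apply/succ_edge_list_rank => //; exact: xb.1.
by move=> j /ym jm; apply/is_min_list_rank => //; exact: (phib x xb).1.
Qed.

(** The Vershik rule determines [phi] at the non-maximal paths near [x], where [vrel_vertical_limit]
    describes the images; continuity of [phi] then settles its value at [x]. *)
Lemma vershik_maxpath phi x v b : vershik rk phi ->
  bpath x -> (forall k, x k = mx k.+1 v) -> sg v b ->
  (forall n, exists y, [/\ bpath y, agree x y n.+1 & ~ maxpath rk y]) ->
  forall k, phi x k = mn k.+1 b.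
Proof.
move=> [phib [_ [_ [phiC [_ [_ [_ phis]]]]]]] xb xv vb xlim k.
have [l Hl] := phiC _ k.+1 xb.
(* Here [l] serves continuity, [N] serves [compat], [k] is the entry compared, and 3 leaves room for
   [1 < k'] and [k.+1 < k']. *)
have [y [yb ay ny]] := xlim (l + N + k + 3).
have [|k' yk' ym'] := @ex_first_nonextremal _ mx y.
  by move/(maxpath_list_rank yb).
have lk : l + N + k + 3 < k'.
  rewrite ltnNge; apply/negP => kl; apply: yk'; rewrite -ay // xv.
  by have [mR _] := list_rank_mx k' v; rewrite (proj2 mR).
have [||pk pj pm] := phis y k' yb.
- by move/(is_max_list_rank (yb.1 k')).
- by move=> j /ym' jm; apply/is_max_list_rank => //; exact: yb.1.
have y0 : erng (y 0) = v.
  by rewrite -ay // xv; have [mR _] := list_rank_mx 0 v; rewrite (proj2 mR).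
have pb := phib y yb.
have [||||b' vb' pb'] := vrel_vertical_limit mxP mnP
  compat yb pb ym' _ _ _ _ y0.
- by apply/succ_edge_list_rank => //; exact: yb.1.
- by move=> j /pm /is_min_list_rank; apply; exact: pb.1.
- by lia.
- by lia.
rewrite (Hl y yb) //; last by move=> j jl; apply: ay; lia.
by rewrite pb' ?(sg_fun vb vb') //; lia.
Qed.
End Vershik.
End Ordering.

(** * Orders compatible with a skeleton *)

Section EdgeLists.
Variable B : bratteli.
Implicit Types (e : edge B) (u v w : 'I_(dim B)).

Definition star n u w : seq (edge B) := [seq (Some w, u, k) | k <- iota 0 (mult n u w)].

Definition in_edges n u : seq (edge B) :=
  match n with
  | 0 => [::]
  | 1 => [seq (None, u, k) | k <- iota 0 (h0 u)]
  | n'.+1 => flatten [seq star n' u w | w <- enum 'I_(dim B)]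
  end.

(* On level-1 edges, whose source is v0, this is a junk value. *)
Definition srcv e : 'I_(dim B) := odflt (erng e) (esrc e).

Lemma mem_star n u w e :
  (e \in star n u w) = [&& esrc e == Some w, erng e == u & eidx e < mult n u w].
Proof.
case: e => [[s v] k]; apply/mapP/and3P; rewrite /esrc /erng /eidx /=.
  by case=> i; rewrite mem_iota /= => ik [-> -> ->].
by case=> /eqP-> /eqP-> kl; exists k; rewrite ?mem_iota.
Qed.

Lemma star_uniq n u w : uniq (star n u w).
Proof. by rewrite map_inj_uniq ?iota_uniq // => i j []. Qed.

Lemma mem_in_edges n u e : e \in in_edges n.+1 u <-> inR n.+1 u e.
Proof.
case: n => [|n]; rewrite /inR /=.
  case: e => [[s v] k]; rewrite /esrc /erng /eidx /=; split.
    by case/mapP=> i; rewrite mem_iota /= => ik [-> -> ->].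
  by move=> [[-> kl] <-]; apply/mapP; exists k; rewrite ?mem_iota.
split.
  case/flatten_mapP => w _; rewrite mem_star => /and3P[/eqP es /eqP ev ek].
  by rewrite ev; split=> //; exists w.
move=> [[w [es ek]] ev]; apply/flatten_mapP; exists w; first by rewrite mem_enum.
by rewrite mem_star es ev !eqxx -ev.
Qed.

Lemma in_edges_count n u (P : pred (edge B)) :
  count P (in_edges n.+2 u) = \sum_w count P (star n.+1 u w).
Proof.
by rewrite /= count_flatten -map_comp sumnE big_map big_enum.
Qed.

Lemma in_edges_uniq n u : uniq (in_edges n.+1 u).
Proof.
case: n => [|n]; first by rewrite map_inj_uniq ?iota_uniq // => i j [].
apply: count_mem_uniq => e; rewrite in_edges_count.
have st w : count_mem e (star n.+1 u w) = (e \in star n.+1 u w).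
  exact/count_uniq_mem/star_uniq.
have [/mem_in_edges eR|eR] := boolP (e \in _); last first.
  rewrite big1 // => w _; rewrite st; apply/eqP; rewrite eqb0.
  apply: contra eR => ew; apply/flatten_mapP; exists w => //.
  by rewrite mem_enum.
have [[w [es ek]] ev] := eR.
rewrite (bigD1 w) //= big1 ?addn0 => [|w' w'w]; rewrite st mem_star.
  by rewrite es ev !eqxx -ev ek.
by rewrite es eq_sym (inj_eq (@Some_inj _)) (negbTE w'w).
Qed.

(** Leaving out [e0] lowers by one the number of edges from its source, just as in [tildef] and
    [barf]. Balance relations and crossing numbers thereby become counts of arcs. *)
Lemma count_in_edges_neq n u e0 (P : pred 'I_(dim B)) : inR n.+2 u e0 ->
  count (fun e => (e != e0) && P (srcv e)) (in_edges n.+2 u)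
  = \sum_(w | P w) (mult n.+1 u w - (esrc e0 == Some w)).
Proof.
move=> [[w0 [e0s e0k]] e0v]; rewrite in_edges_count [RHS]big_mkcond /=.
apply: eq_bigr => w _.
have -> : count (fun e => (e != e0) && P (srcv e)) (star n.+1 u w)
        = count (fun e => (e != e0) && P w) (star n.+1 u w).
  apply: eq_in_count => e; rewrite mem_star => /and3P[/eqP es _ _].
  by rewrite /srcv es.
case: (P w); last by rewrite (eq_count (a2 := pred0)) ?count_pred0 // => e; rewrite andbF.
rewrite (eq_count (a2 := predC (pred1 e0))); last by move=> e; rewrite /= andbT.
have := count_predC (pred1 e0) (star n.+1 u w).
rewrite count_uniq_mem ?star_uniq // mem_star size_map size_iota e0v eqxx /= => <-.
have -> : (esrc e0 == Some w) && (eidx e0 < mult n.+1 u w) = (esrc e0 == Some w).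
  by apply: andb_idr; rewrite e0s => /eqP[<-]; rewrite -e0v.
by rewrite addnC addnK.
Qed.
End EdgeLists.

(** * Extremal edges and Eulerian orders from the skeleton *)

Section Main.
Variables (B : bratteli) (Vt Vb : {set 'I_(dim B)})
  (M m : 'I_(dim B) -> nat -> edge B) (tv bv : 'I_(dim B) -> 'I_(dim B))
  (te be : nat -> 'I_(dim B) -> edge B) (sigma : 'I_(dim B) -> 'I_(dim B)).
Hypothesis rankB : strict_rank B.
Hypothesis skel : is_skeleton Vt Vb M m tv bv te be.
Hypothesis bij : bij_on sigma Vt Vb.

(* The skeleton prescribes level-1 edges only at the vertices of Vt and Vb;
   elsewhere any two distinct edges will do. *)
Definition other_edge (v : 'I_(dim B)) (e : edge B) : edge B :=
  if e == (None, v, 0) then (None, v, 1) else (None, v, 0).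

(** Outside [Vt] the edge [m v 0] is avoided because [min1] takes it when [v] is in [Vb]. *)
Definition max1 v := if v \in Vt then M v 0 else other_edge v (m v 0).
Definition min1 v := if v \in Vb then m v 0 else other_edge v (max1 v).
Definition skel_max n v := if n is 1 then max1 v else te n v.
Definition skel_min n v := if n is 1 then min1 v else be n v.

Lemma other_edgeP v e : inR 1 v (other_edge v e) /\ other_edge v e <> e.
Proof.
have := rankB.2.1 v => h2; rewrite /other_edge; case: eqP => [->|ne]; split=> //.
  by split=> //; split=> //; exact: ltnW.
by move=> E; apply: ne.
Qed.

Lemma skel_edges n v : [/\ inR n.+1 v (skel_max n.+1 v), inR n.+1 v (skel_min n.+1 v)
  & skel_min n.+1 v != skel_max n.+1 v].
Proof.
case: skel => _ [Mv [mv [Mm [_ [_ sk]]]]].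
case: n => [|n] /=; last first.
  by have [? [? [ne _]]] := sk n.+2 v isT; split=> //; apply/eqP => E; exact: ne.
have MR : v \in Vt -> inR 1 v (M v 0) by move=> /Mv[[? _] ?]; split=> //.
have mR : v \in Vb -> inR 1 v (m v 0) by move=> /mv[[? _] ?]; split=> //.
have oR e := (other_edgeP v e).1; have oN e := (other_edgeP v e).2.
rewrite /min1 /max1; case: ifP => vt; case: ifP => vb; split; auto; apply/eqP; auto.
by apply/nesym; exact: Mm.
Qed.

(** For [v] in [Vt], the level-2 edge of the vertical path [M v] is [te 2 v], so its source is both
    [v] and [tv v]. *)
Lemma skel_fixed_max v : v \in Vt <-> tv v = v.
Proof.
case: skel => _ [Mv [_ [_ [tvt [_ sk]]]]]; split=> [vt|<-]; last exact: tvt.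
have [_ [_ [_ [ts [_ [tM _]]]]]] := sk 2 v isT.
have [[_ Ms] Mr] := Mv v vt.
by apply/Some_inj; rewrite -ts tM // Ms Mr.
Qed.

Lemma skel_fixed_min v : v \in Vb <-> bv v = v.
Proof.
case: skel => _ [_ [mv [_ [_ [bvb sk]]]]]; split=> [vb|<-]; last exact: bvb.
have [_ [_ [_ [_ [bs [_ bm]]]]]] := sk 2 v isT.
have [[_ ms] mr] := mv v vb.
by apply/Some_inj; rewrite -bs bm // ms mr.
Qed.

Lemma skel_max_family : extremal_family skel_max tv.
Proof.
case: skel => _ [_ [_ [_ [tvt [_ sk]]]]]; split=> [n v|n v|v].
- by case: (skel_edges n v).
- by have [_ [_ [_ [ts _]]]] := sk n.+2 v isT.
- exact/skel_fixed_max/tvt.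
Qed.

Lemma skel_min_family : extremal_family skel_min bv.
Proof.
case: skel => _ [_ [_ [_ [_ [bvb sk]]]]]; split=> [n v|n v|v].
- by case: (skel_edges n v).
- by have [_ [_ [_ [_ [bs _]]]]] := sk n.+2 v isT.
- exact/skel_fixed_min/bvb.
Qed.

Lemma skel_maxE v k : v \in Vt -> M v k = skel_max k.+1 v.
Proof.
case: skel => _ [_ [_ [_ [_ [_ sk]]]]] vt; case: k => [|k]; first by rewrite /= /max1 vt.
by have [_ [_ [_ [_ [_ [tM _]]]]]] := sk k.+2 v isT; rewrite /= tM.
Qed.

Lemma skel_minE v k : v \in Vb -> m v k = skel_min k.+1 v.
Proof.
case: skel => _ [_ [_ [_ [_ [_ sk]]]]] vb; case: k => [|k]; first by rewrite /= /min1 vb.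
by have [_ [_ [_ [_ [_ [_ bm]]]]]] := sk k.+2 v isT; rewrite /= bm.
Qed.

Definition link (e f : edge B) := sigma (tv (srcv e)) == bv (srcv f).

(** The vertices of H with positive crossing number are the classes [pr f] of the arcs [f] other
    than [te n.+1 u]. A path in H between two classes lifts to arcs that may follow one another,
    which gives the connectedness that the trail requires. *)
Lemma eulerian_order n u : 0 < n ->
  pos_strongly_connected Vt Vb tv bv te sigma n -> balanced Vt tv bv te be sigma n ->
  exists l, [/\ perm_eq (be n.+1 u :: l) (in_edges n.+1 u),
    last (be n.+1 u) l = te n.+1 u & path link (be n.+1 u) l].
Proof.
case: n => [//|n] _ psc bal.
have [sVb [sinj ssurj]] := bij.
case: skel => _ [_ [_ [_ [tvt [bvb sk]]]]].
have [tR [bR [/eqP tb _]]] := sk n.+2 u isT.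
apply: (eulerian_trail_seq (tau := fun e => bv (srcv e))
  (eta := fun e => sigma (tv (srcv e)))).
- exact: in_edges_uniq.
- exact/mem_in_edges.
- exact/mem_in_edges.
(* Outside [Vb] no arc starts or ends; at [sigma t] the equality is the balance relation for [t]. *)
- move=> v; have [/ssurj[t tt <-]|vb] := boolP (v \in Vb); last first.
    rewrite !(eq_count (a2 := pred0)) ?count_pred0 // => e /=.
      by rewrite andbC; case: eqP => // E; rewrite -E bvb in vb.
    by rewrite andbC; case: eqP => // E; rewrite -E sVb in vb.
  rewrite (count_in_edges_neq (fun w => bv w == sigma t) bR).
  rewrite -(bal u t tt) -(count_in_edges_neq (fun w => tv w == t) tR).
  apply: eq_count => e; congr andb; apply/eqP/eqP => [|-> //].
  exact: sinj.
move=> A As clA e eE et.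
pose S p := Hvert Vt Vb tv bv p && (0 < crossing te tv bv n.+1 u p).
pose pr e : 'I_(dim B) * 'I_(dim B) := (bv (srcv e), tv (srcv e)).
have crossE p : crossing te tv bv n.+1 u p
    = count (fun e => (e != te n.+2 u) && (pr e == p)) (in_edges n.+2 u).
  rewrite /crossing -(count_in_edges_neq (fun w => (bv w == p.1) && (tv w == p.2)) tR).
  by case: p.
have SP p : S p -> exists f, [/\ f \in in_edges n.+2 u, f != te n.+2 u & pr f = p].
  case/andP => _; rewrite crossE -has_count => /hasP[f fE /andP[ft /eqP fp]].
  by exists f.
have Spr f : f \in in_edges n.+2 u -> f != te n.+2 u -> S (pr f).
  move=> fE ft; apply/andP; split.
    rewrite /Hvert /= bvb tvt /=; apply/existsP; exists (srcv f).
    by rewrite !eqxx.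
  by rewrite crossE -has_count; apply/hasP; exists f; rewrite // ft eqxx.
have bE : be n.+2 u \in in_edges n.+2 u by exact/mem_in_edges.
have bt : be n.+2 u != te n.+2 u by rewrite eq_sym.
have /connectP[p pp pl] := psc u _ _ (Spr _ bE bt) (Spr _ eE et).
(* [Q] is carried along the path in H from the class of [be n.+2 u] to that of [e]. Arcs of one
   class have the same head, so [A] then passes from [f] to [e]. *)
pose Q p := exists f, [/\ f \in in_edges n.+2 u, f != te n.+2 u, A f & pr f = p].
suff [f [fE ft Af fe]] : Q (pr e).
  by apply: (clA f) => //; left; case: fe => _ ->.
have Qb : Q (pr (be n.+2 u)) by exists (be n.+2 u).
rewrite pl; elim: p (pr (be n.+2 u)) Qb pp {pl} => [//|q p IH] q0 Q0 /= /andP[].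
move=> /and3P[_ Sq q0q]; apply: IH.
case: Q0 => f [fE ft Af fq]; have [g [gE gt gq]] := SP _ Sq.
exists g; split=> //; apply: (clA f) => //; right.
by rewrite -fq -gq in q0q; exact/eqP.
Qed.

(** At low levels only the two end edges matter. Over a single vertex all arcs are loops, so balance
    and connectedness are automatic. *)
Lemma any_order n u : exists l,
  perm_eq (skel_min n.+1 u :: l) (in_edges n.+1 u) /\
    last (skel_min n.+1 u) l = skel_max n.+1 u.
Proof.
have [xR nR ne] := skel_edges n u.
have [||||| l [pl ll _]] := @eulerian_trail_seq _ unit (in_edges n.+1 u)
  (fun=> tt) (fun=> tt) (skel_min n.+1 u) (skel_max n.+1 u).
- exact: in_edges_uniq.
- exact/mem_in_edges.
- exact/mem_in_edges.
- case; rewrite (eq_count (a2 := predC1 (skel_max n.+1 u))); last first.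
    by move=> e; rewrite /= eqxx andbT.
  rewrite [RHS](eq_count (a2 := predC1 (skel_min n.+1 u))); last first.
    by move=> e; rewrite /= eqxx andbT.
  have := count_predC (pred1 (skel_min n.+1 u)) (in_edges n.+1 u).
  rewrite -(count_predC (pred1 (skel_max n.+1 u)) (in_edges n.+1 u)).
  have [/mem_in_edges xE /mem_in_edges nE] := (xR, nR).
  by rewrite !count_uniq_mem ?in_edges_uniq // xE nE => -[].
- move=> A As clA e eE _; apply: (clA (skel_min n.+1 u)) => //; last by left.
  exact/mem_in_edges.
by exists l.
Qed.

Hypothesis simpleB : simple B.

(** After following [M v] to level [n.+1], simplicity leads to a vertex of [Vb]. The path continues
    along the minimal vertical path there, whose edges are not maximal. *)
Lemma vertical_not_isolated n v : v \in Vt ->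
  exists y, [/\ bpath y, agree (M v) y n.+1
              & exists k, y k <> skel_max k.+1 (erng (y k))].
Proof.
move=> vt; have [xb rx] : bpath (M v) /\ erng (M v n) = v.
  by case: skel => _ [/(_ _ vt)[? ?] _].
have vb : bv v \in Vb by case: skel => _ [_ [_ [_ [_ []]]]].
move/skel_fixed_min: vb; move: (bv v) => b vb.
have zb := vertical_extremal skel_min_family vb.
have [k [k0 /(_ v b) c]] := simpleB (ltn0Sn n).
have rm j : erng (skel_min j.+1 b) = b by case: (skel_edges j b) => _ [].
have [y [py ya yw]] := conn_path xb rx c.
exists (glue (n + k).+1 y (fun k => skel_min k.+1 b)); split.
- by apply: bpath_glue => //; rewrite yw rm.
- by move=> j jn; rewrite /glue ifT ?ya //; lia.
exists (n + k).+1; rewrite /glue ltnn rm; apply/eqP.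
by case: (skel_edges (n + k).+1 b).
Qed.
End Main.

(** * Assembly of the perfect ordering *)

Theorem mainTheorem15 (B : bratteli) (Vt Vb : {set 'I_(dim B)})
  (M m : 'I_(dim B) -> nat -> edge B) (tv bv : 'I_(dim B) -> 'I_(dim B))
  (te be : nat -> 'I_(dim B) -> edge B) (sigma : 'I_(dim B) -> 'I_(dim B)) :
  strict_rank B -> simple B ->
  is_skeleton Vt Vb M m tv bv te be ->
  bij_on sigma Vt Vb ->
  (exists N, forall n, N <= n ->
     pos_strongly_connected Vt Vb tv bv te sigma n /\
     balanced Vt tv bv te be sigma n) ->
  exists rk : nat -> edge B -> nat,
    is_ordering rk /\ perfect rk /\
    [/\
        (forall x, bpath x -> (maxpath rk x <-> exists2 v, v \in Vt & eqp x (M v))),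
        (forall x, bpath x -> (minpath rk x <-> exists2 v, v \in Vb & eqp x (m v))),
        (forall n w, 2 <= n -> is_max rk n (te n w) /\ is_min rk n (be n w)) &
        (forall phi, vershik rk phi ->
           forall v, v \in Vt -> eqp (phi (M v)) (m (sigma v)))].
Proof.
move=> rankB simpleB skel bij [N HN].
pose mx := skel_max Vt M m te; pose mn := skel_min Vt Vb M m be.
have mxP := skel_max_family rankB skel; have mnP := skel_min_family rankB skel.
have mxR n v : inR n.+1 v (mx n.+1 v) by case: (skel_edges rankB skel n v).
have mnR n v : inR n.+1 v (mn n.+1 v) by case: (skel_edges rankB skel n v).
(* Boolean, so that [xchoose] selects the lists. The index [n] stands for level [n.+1]; the
   threshold [N.+1] makes [n] positive, so that [mn] and [mx] are [be] and [te] there. *)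
pose good n u l := [&& perm_eq (mn n.+1 u :: l) (in_edges n.+1 u),
  last (mn n.+1 u) l == mx n.+1 u
  & (N.+1 <= n) ==> path (link tv bv sigma) (mn n.+1 u) l].
have good_ex n u : exists l, good n u l.
  have [Nn|Nn] := ltnP N n; last first.
    have [l [pl ll]] := any_order rankB skel n u.
    by exists l; rewrite /good pl ll eqxx ltnNge Nn.
  have [psc bal] := HN n (ltnW Nn).
  have [l [pl ll sl]] := eulerian_order skel bij u (leq_ltn_trans (leq0n N) Nn) psc bal.
  by exists l; case: n Nn {psc bal} pl ll sl => // n Nn pl ll sl; rewrite /good pl ll eqxx sl implybT.
pose L n u := mn n u :: xchoose (good_ex n.-1 u).
have LP n u : good n u (xchoose (good_ex n u)) by exact: xchooseP.
have L_uniq n u : uniq (L n.+1 u).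
  by case/and3P: (LP n u) => /perm_uniq-> _ _; exact: in_edges_uniq.
have mem_L n u e : e \in L n.+1 u <-> inR n.+1 u e.
  by case/and3P: (LP n u) => /perm_mem-> _ _; exact: mem_in_edges.
have L_mn n u : exists l, L n.+1 u = mn n.+1 u :: l by eexists.
have L_mx n u : exists l, L n.+1 u = rcons l (mx n.+1 u).
  case/and3P: (LP n u) => _ /eqP <- _; rewrite /L /= lastI; by eexists.
have [sVb [sinj ssurj]] := bij.
(* Since [sigma] is injective only on [Vt], membership in [Vt] is included to make [sg]
   injective. *)
pose sg v b := v \in Vt /\ b = sigma v.
have sg_ex v : tv v = v -> exists2 b, bv b = b & sg v b.
  move/(skel_fixed_max skel) => vt; exists (sigma v) => //.
  exact/(skel_fixed_min skel)/sVb.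
have sg_xe b : bv b = b -> exists2 v, tv v = v & sg v b.
  move/(skel_fixed_min skel)/ssurj => [v vt <-]; exists v => //.
  exact/(skel_fixed_max skel).
have sg_fun v b b' : sg v b -> sg v b' -> b = b' by move=> [_ ->] [_ ->].
have sg_inj v v' b : sg v b -> sg v' b -> v = v'.
  by move=> [vt ->] [vt' E]; exact: sinj.
have compat n e f w u : N.+1 < n -> next_edge L n e f ->
    esrc e = Some w -> esrc f = Some u -> sg (tv w) (bv u).
  case: n => [//|n] Nn ef ew fu; split.
    by case: skel => _ [_ [_ [_ [tvt _]]]]; exact: tvt.
  have srt : sorted (link tv bv sigma) (L n.+1 (erng e)).
    by case/and3P: (LP n (erng e)) => _ _ /implyP; apply.
  have := next_edge_sorted mem_L srt ef.
  by rewrite /link /srcv ew fu => /eqP.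
exists (list_rank L); split; [|split; [|split]].
- by move=> n v e f eR fR; exact: (list_rank_inj mem_L eR fR).
- exact: (list_rank_perfect L_uniq mem_L L_mn L_mx mxP mnP sg_ex sg_xe sg_fun sg_inj compat).
- move=> x xb; rewrite (maxpath_list_rank L_uniq mem_L L_mx xb); split.
    move=> xm; have [vt xv] := extremal_vertical mxP xb xm erefl.
    exists (erng (x 0)); first exact/(skel_fixed_max skel).
    by move=> k; rewrite (skel_maxE skel) //; exact/(skel_fixed_max skel).
  by case=> v vt xM k; rewrite xM (skel_maxE skel) // (mxR k v).2.
- move=> x xb; rewrite (minpath_list_rank mem_L L_mn xb); split.
    move=> xm; have [vt xv] := extremal_vertical mnP xb xm erefl.
    exists (erng (x 0)); first exact/(skel_fixed_min skel).
    by move=> k; rewrite (skel_minE skel) //; exact/(skel_fixed_min skel).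
  by case=> v vt xM k; rewrite xM (skel_minE skel) // (mnR k v).2.
- case=> [|[|n]] // w _; split.
    apply/(is_max_list_rank L_uniq mem_L L_mx (mxR n.+1 w).1).
    by rewrite (mxR n.+1 w).2.
  apply/(is_min_list_rank mem_L L_mn (mnR n.+1 w).1).
  by rewrite (mnR n.+1 w).2.
move=> phi phiV v vt k; rewrite (skel_minE skel _ (sVb v vt)).
apply: (vershik_maxpath L_uniq mem_L L_mn L_mx mxP mnP sg_fun compat phiV (v := v)) => //.
- by case: skel => _ [/(_ _ vt)[]].
- by move=> j; exact: (skel_maxE skel).
move=> n; have [y [yb ya [j yj]]] := vertical_not_isolated rankB skel simpleB n vt.
exists y; split=> // /(maxpath_list_rank L_uniq mem_L L_mx yb) ym.
exact: yj.
Qed.
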